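(* For any graph $G$ with minimum degree $\delta(G)=1$ and maximum degree $\Delta(G)$, we have $SC(G)\le 2+2\Delta(G)$.
   Context: Graphs are finite, simple and undirected, with nonempty vertex set $V(G)$; the order is $n=|V(G)|$. A set $D\subseteq V(G)$ is a strong dominating set of $G$ if for every $x\in V(G)\setminus D$ there is $y\in D$ with $xy\in E(G)$ and $\deg(x)\le\deg(y)$. Two disjoint sets $V_1,V_2\subseteq V(G)$ form a strong coalition if neither is a strong dominating set but $V_1\cup V_2$ is a strong dominating set. A strong coalition partition of $G$ is a partition $\Omega=\{V_1,\dots,V_k\}$ of $V(G)$ into nonempty sets such that each $V_i$ either is a strong dominating set consisting of a single vertex of degree $n-1$, or is not a strong dominating set but forms a strong coalition with another set $V_j\in\Omega$ that is not a strong dominating set. The strong coalition number $SC(G)$ is the maximum cardinality of a strong coalition partition of $G$, with $SC(G)=0$ if $G$ has no strong coalition partition. *)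

(* Defs.v *)
From mathcomp Require Import all_boot.

Set Implicit Arguments.
Unset Strict Implicit.
Unset Printing Implicit Defensive.

Record sgraph := SGraph {
  svertex :> finType;
  sedge : rel svertex;
  sedge_sym : symmetric sedge;
  sedge_irrefl : irreflexive sedge;
  sgraph_nonempty : 0 < #|svertex|
}.

Section StrongCoalition.

Variable G : sgraph.

Definition deg (x : G) : nat := #|[set y | sedge x y]|.

(* All degrees are smaller than #|G|, so that the neutral element #|G| does not
   affect the minimum. *)
Definition min_degree : nat := \big[minn/#|G|]_(x : G) deg x.

Definition max_degree : nat := \max_(x : G) deg x.

Definition strong_dominating (D : {set G}) : bool :=
  [forall x, (x \notin D) ==>
     [exists y, [&& y \in D, sedge x y & deg x <= deg y]]].

Definition strong_coalition (V1 V2 : {set G}) : bool :=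
  [&& [disjoint V1 & V2], ~~ strong_dominating V1, ~~ strong_dominating V2
    & strong_dominating (V1 :|: V2)].

Definition dominating_singleton (V : {set G}) : bool :=
  strong_dominating V && [exists v, (V == [set v]) && (deg v == #|G|.-1)].

Definition strong_coalition_partition (Omega : {set {set G}}) : bool :=
  partition Omega [set: G] &&
  [forall V in Omega,
     dominating_singleton V
     || (~~ strong_dominating V
         && [exists W in Omega, [&& W != V, ~~ strong_dominating W
                                  & strong_coalition V W]])].

(* The maximum over an empty range is 0, as required when G has no strong
   coalition partition. *)
Definition strong_coalition_number : nat :=
  \max_(Omega : {set {set G}} | strong_coalition_partition Omega) #|Omega|.

End StrongCoalition.

(* Main.v *)
Require Import Defs.
From mathcomp Require Import all_boot.

(** Let [x] be a vertex of degree 1, [y] its neighbour, and let [X], [Y] be the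
blocks of a strong coalition partition [Omega] that contain [x] and [y]
(possibly [X = Y]).  A strong dominating set contains [x] or [y], so a block
other than [X] and [Y] is not strong dominating, and its coalition partner can
only be [X] or [Y] ([coalition_with_leaf_block]).

A set is strong dominating iff it meets the strong closed neighbourhood of each
vertex [z], which has at most [Delta + 1] elements; hence at most [Delta + 1]
blocks meet it.  If [X] has a partner, it is not strong dominating, so it misses
the strong closed neighbourhood of some [z], and all partners of [X] meet it.
Either all blocks other than [X] and [Y] meet it, and there are at most
[Delta + 1] of them; or one of these blocks, [A], misses it, so [A] is a partner
of [Y], the union of [A] and [Y] meets it, hence [Y] does, and since [Y] uses up
one of the [Delta + 1] places, [X] has at most [Delta] partners besides [Y]
([card_partners]).  The same holds with [X] and [Y] exchanged, so there are at
most [2 + maxn (Delta + 1) (2 * Delta)] blocks, and [Delta >= 1]. *)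

Section StrongCoalitionBound.

Set Implicit Arguments.
Unset Strict Implicit.

Variable G : sgraph.
Implicit Types (x y z v : G) (A B D X Y : {set G}) (Omega : {set {set G}}).

(** The strong closed neighbourhood of [z]: the vertices that strongly
dominate [z], including [z] itself. *)
Definition strong_nbhd z : {set G} :=
  z |: [set v | sedge z v & deg z <= deg v].

Lemma card_strong_nbhd z : #|strong_nbhd z| <= (max_degree G).+1.
Proof.
apply: leq_trans (leq_card_setU _ _) _; rewrite cards1 add1n ltnS.
apply: leq_trans (leq_bigmax z); apply: subset_leq_card.
by apply/subsetP => v; rewrite !inE => /andP[].
Qed.

Lemma strong_dominatingP D :
  reflect (forall z, ~~ [disjoint D & strong_nbhd z]) (strong_dominating D).
Proof.
apply: (iffP forallP) => domD z.
  have /implyP := domD z; have [zD _|zD /(_ isT)] := boolP (z \in D).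
    by apply/pred0Pn; exists z; rewrite /= zD !inE eqxx.
  case/existsP => v /and3P[vD zv le_zv].
  by apply/pred0Pn; exists v; rewrite /= vD !inE zv le_zv orbT.
apply/implyP => zD; have /pred0Pn[v /= /andP[vD]] := domD z.
rewrite !inE => /orP[/eqP vz|/andP[zv le_zv]].
  by rewrite -vz vD in zD.
by apply/existsP; exists v; rewrite vD zv le_zv.
Qed.

(** Each of the disjoint blocks is determined by any point of [D] in it. *)
Lemma card_blocks_meeting Omega (F : {set {set G}}) D :
    trivIset Omega -> F \subset Omega ->
    (forall A, A \in F -> ~~ [disjoint A & D]) ->
  #|F| <= #|D|.
Proof.
move=> trivO /subsetP FO meetF; apply: leq_trans (leq_imset_card (pblock Omega) D).
apply: subset_leq_card; apply/subsetP => A AF.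
have /pred0Pn[v /= /andP[vA vD]] := meetF A AF.
by apply/imsetP; exists v; rewrite // (def_pblock trivO (FO A AF) vA).
Qed.

Lemma strong_coalition_meets X A z :
    strong_coalition X A -> [disjoint X & strong_nbhd z] ->
  ~~ [disjoint A & strong_nbhd z].
Proof.
case/and4P => _ _ _ /strong_dominatingP/(_ z) meetU dXz.
by apply: contra meetU => dAz; rewrite -setI_eq0 setIUl setU_eq0 !setI_eq0 dXz.
Qed.

Lemma strong_coalition_sym A B : strong_coalition A B = strong_coalition B A.
Proof.
by rewrite /strong_coalition disjoint_sym setUC; congr (_ && _); rewrite andbCA.
Qed.

(** The second bound improves by one on the evident bound [Delta + 1] for the
number of partners of [X]; the saving comes from [Y], which meets the same
strong closed neighbourhood as those partners. *)
Lemma card_partners Omega X Y :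
    trivIset Omega -> Y \in Omega ->
    (forall A, A \in Omega :\: [set X; Y] ->
      strong_coalition X A || strong_coalition Y A) ->
  #|Omega :\: [set X; Y]| <= (max_degree G).+1 \/
  #|[set A in Omega :\: [set X; Y] | strong_coalition X A]| <= max_degree G.
Proof.
set P := _ :\: _; set PX := [set A in P | _] => trivO YO coalP.
have sPO : P \subset Omega by apply: subsetDl.
have sPXP : PX \subset P by apply/subsetP => A; rewrite inE => /andP[].
have [domX|/strong_dominatingP ndomX] := boolP (strong_dominating X).
  (* A strong dominating set has no coalition partner. *)
  right; rewrite (_ : PX = set0) ?cards0 //; apply/setP => A.
  by rewrite !inE /strong_coalition domX /= !andbF.
have /existsP[z dXz] : [exists z, [disjoint X & strong_nbhd z]].
  by apply: contra_notT ndomX => /existsPn.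
have [/forall_inP meetP|] :=
    boolP [forall A in P, ~~ [disjoint A & strong_nbhd z]].
  left; apply: leq_trans (card_strong_nbhd z).
  exact: card_blocks_meeting trivO sPO meetP.
case/forall_inPn => A AP /negPn dAz; right.
have coalYA : strong_coalition Y A.
  have /orP[/strong_coalition_meets/(_ dXz)|//] := coalP A AP.
  by rewrite dAz.
have meetY : ~~ [disjoint Y & strong_nbhd z].
  by apply: strong_coalition_meets dAz; rewrite strong_coalition_sym.
have YPX : Y \notin PX by rewrite !inE eqxx orbT.
suff: #|Y |: PX| <= (max_degree G).+1 by rewrite cardsU1 YPX.
apply: leq_trans (card_strong_nbhd z); apply: card_blocks_meeting trivO _ _.
  by rewrite subUset sub1set YO (subset_trans sPXP).
move=> B /setU1P[-> //|]; rewrite inE => /andP[_ coalXB].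
exact: strong_coalition_meets coalXB dXz.
Qed.

Lemma leaf_in_strong_dominating x y D :
  [set v | sedge x v] = [set y] -> strong_dominating D ->
  (x \in D) || (y \in D).
Proof.
move=> Nx /forallP/(_ x); case: (x \in D) => //= /existsP[v /and3P[vD xv _]].
have: v \in [set v | sedge x v] by rewrite inE.
by rewrite Nx => /set1P <-.
Qed.

Lemma coalition_with_leaf_block Omega x y A :
    [set v | sedge x v] = [set y] -> strong_coalition_partition Omega ->
    A \in Omega :\: [set pblock Omega x; pblock Omega y] ->
  strong_coalition (pblock Omega x) A || strong_coalition (pblock Omega y) A.
Proof.
move=> Nx /andP[/and3P[_ trivO _] /forall_inP scp].
rewrite !inE negb_or => /andP[/andP[AX AY] AO].
have xA : x \notin A.
  by apply: contraNN AX => xA; rewrite (def_pblock trivO AO xA).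
have yA : y \notin A.
  by apply: contraNN AY => yA; rewrite (def_pblock trivO AO yA).
have ndomA : ~~ strong_dominating A.
  by apply/negP => /(leaf_in_strong_dominating Nx); rewrite (negPf xA) (negPf yA).
have := scp A AO; rewrite /dominating_singleton (negPf ndomA) /=.
case/exists_inP => B BO /and3P[_ _ coalAB].
have /and4P[_ _ _ /(leaf_in_strong_dominating Nx)] := coalAB.
rewrite !inE (negPf xA) (negPf yA) /= strong_coalition_sym in coalAB *.
by case/orP => vB; rewrite (def_pblock trivO BO vB) coalAB ?orbT.
Qed.

Lemma card_strong_coalition_partition Omega x :
    deg x = 1 -> strong_coalition_partition Omega ->
  #|Omega| <= 2 + 2 * max_degree G.
Proof.
move=> dx scpO; have /andP[/and3P[/eqP covO trivO _] _] := scpO.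
have Delta_gt0 : 0 < max_degree G by rewrite -dx; apply: leq_bigmax.
have /cards1P[y Nx] : #|[set v | sedge x v]| == 1 by rewrite -dx.
set X := pblock Omega x; set Y := pblock Omega y.
have XO : X \in Omega by rewrite pblock_mem // covO.
have YO : Y \in Omega by rewrite pblock_mem // covO.
have coalP A (AP : A \in Omega :\: [set X; Y]) :=
  coalition_with_leaf_block Nx scpO AP.
have leO : #|Omega| <= 2 + #|Omega :\: [set X; Y]|.
  rewrite -(cardsID [set X; Y] Omega) leq_add2r.
  apply: leq_trans (subset_leq_card (subsetIr _ _)) _.
  by rewrite cards2; case: (_ != _).
apply: leq_trans leO _; rewrite leq_add2l.
have few : #|Omega :\: [set X; Y]| <= (max_degree G).+1 ->
    #|Omega :\: [set X; Y]| <= 2 * max_degree G.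
  by move/leq_trans; apply; rewrite mul2n -addnn -add1n leq_add2r.
have [/few //|leX] := card_partners trivO YO coalP.
have coalP' A : A \in Omega :\: [set Y; X] ->
    strong_coalition Y A || strong_coalition X A.
  by rewrite setUC orbC; apply: coalP.
have := card_partners trivO XO coalP'; rewrite [[set Y; X]]setUC.
case=> [/few //|leY].
rewrite mul2n -addnn; apply: leq_trans (leq_add leX leY).
apply: leq_trans (leq_card_setU _ _); apply: subset_leq_card.
apply/subsetP => A AP; rewrite in_setU !inE.
by have := coalP A AP; move: AP; rewrite !inE => ->.
Qed.

Lemma min_degree_leq x : min_degree G <= deg x.
Proof.
rewrite /min_degree; have: x \in index_enum G by rewrite mem_index_enum.
elim: (index_enum G) => // z s IHs; rewrite inE big_cons geq_min.
by case/predU1P => [->|/IHs->]; rewrite ?leqnn ?orbT.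
Qed.

Lemma deg_lt_order x : deg x < #|G|.
Proof.
rewrite -cardsT; apply: proper_card; apply/properP; split; first exact: subsetT.
by exists x; rewrite ?inE // sedge_irrefl.
Qed.

Lemma min_degree_attained : exists x, deg x = min_degree G.
Proof.
have /card_gt0P[x0 _] := sgraph_nonempty G.
case: (@arg_minnP _ x0 xpredT (@deg G) isT) => x _ minx; exists x.
apply/eqP; rewrite eqn_leq min_degree_leq andbT /min_degree.
elim/big_ind: _ => [|m n le_m le_n|z _]; first exact/ltnW/deg_lt_order.
  by rewrite leq_min le_m.
exact: minx.
Qed.

End StrongCoalitionBound.

Theorem theorem3p7 (G : sgraph) (hmin : min_degree G = 1) :
  strong_coalition_number G <= 2 + 2 * max_degree G.
Proof.
have [x dx] := min_degree_attained G; rewrite hmin in dx.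
by apply/bigmax_leqP => Omega; apply: card_strong_coalition_partition dx.
Qed.
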